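(* Let $q$ be a prime power, $n\ge2$ an integer, and $g=\gcd(n,q-1)$. Write $g=p_1^{r_1}\cdots p_s^{r_s}$ with distinct primes $p_i$ and $r_1,\dots,r_s\ge1$, and $q-1=p_1^{a_1}\cdots p_s^{a_s}q_1^{b_1}\cdots q_t^{b_t}$ with $p_1,\dots,p_s,q_1,\dots,q_t$ distinct primes and all $b_i \geq 1$. Then the collection of subgroups $$\{Q\cdot D_1,\ \mathrm{GL}_n(\mathbb{F}_q)^{q_1^{b_1}},\dots,\mathrm{GL}_n(\mathbb{F}_q)^{q_t^{b_t}}\}$$ of $\mathrm{GL}_n(\mathbb{F}_q)$ is a faithful collection, and the corresponding faithful permutation representation has size $$\frac{q^n-1}{q-1}\cdot(q-1)_{n,q}+T_{n,q}(q-1).$$ If $g=1$, then the collection of subgroups $$\{P\cdot D_1,\ \mathrm{GL}_n(\mathbb{F}_q)^{q_1^{b_1}},\dots,\mathrm{GL}_n(\mathbb{F}_q)^{q_t^{b_t}}\}$$ is a faithful collection, and the corresponding faithful permutation representation has size $$\frac{q^n-1}{q-1}+T_{n,q}(q-1).$$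
   Context: For a divisor $t$ of $q-1$, $A_t$ is the unique subgroup of $\mathbb{F}_q^\times$ of order $(q-1)/t$, $\mathrm{GL}_n(\mathbb{F}_q)^t=\{h\in\mathrm{GL}_n(\mathbb{F}_q):\det h\in A_t\}$, and $D_1=\{\mathrm{diag}(a,1,\dots,1): a\in\mathbb{F}_q^\times\}$. With $q-1=p_1^{a_1}\cdots p_s^{a_s}q_1^{b_1}\cdots q_t^{b_t}$, where the $p_i$ are exactly the primes dividing $\gcd(n,q-1)$, set $(q-1)_{n,q}=p_1^{a_1}\cdots p_s^{a_s}$ and $T_{n,q}(q-1)=\sum_{i=1}^t q_i^{b_i}$ (an empty product is $1$ and an empty sum is $0$). $P$ is the set of all matrices $\begin{pmatrix} B&x\\0&b\end{pmatrix}$ with $B\in\mathrm{GL}_{n-1}(\mathbb{F}_q)$, $x\in\mathbb{F}_q^{n-1}$, $b^{-1}=\det B$. $Q$ is the set of all matrices $\begin{pmatrix} C&x\\0&c\end{pmatrix}$ with $C\in\mathrm{GL}_{n-1}(\mathbb{F}_q)$, $x\in\mathbb{F}_q^{n-1}$, $c^{-1}=\det C\in A_{(q-1)_{n,q}}$. A finite collection $\{H_1,\dots,H_\ell\}$ of subgroups of a finite group $G$ is faithful if $\mathrm{core}_G(H_1\cap\dots\cap H_\ell)=\{e\}$, where $\mathrm{core}_G(H)=\bigcap_{x\in G}xHx^{-1}$; the corresponding permutation representation is the left action of $G$ on the disjoint union of the $G/H_i$, of size $\sum_i[G:H_i]$. *)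

(* Defs.v *)
From mathcomp Require Import all_boot all_order all_fingroup all_algebra.
From mathcomp Require Import all_solvable.
Set Implicit Arguments.
Unset Strict Implicit.
Unset Printing Implicit Defensive.
Import GroupScope GRing.Theory.

Section PermutationRepresentations.

Variable gT : finGroupType.
Implicit Types (G : {group gT}) (Hs : seq {set gT}).

(* The members are sets rather than {group gT}, so that a product of subgroups
   (a subgroup only by a proof) can be listed directly. *)
Definition subgroup_collection G Hs : bool :=
  all (fun H : {set gT} => group_set H && (H \subset G)) Hs.

(* gcore H G intersects the conjugates x^-1 H x, x in G; as G is a group these
   are the conjugates x H x^-1. *)
Definition faithful_collection G Hs : Prop :=
  gcore (\bigcap_(H <- Hs) H) G = 1.

(* The disjoint union of the G / H_i: pairs of an index i and a left coset of
   H_i in G. *)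
Definition permrep_set G Hs : {set 'I_(size Hs) * {set gT}} :=
  [set p | p.2 \in lcosets (tnth (in_tuple Hs) p.1) G].

(* MathComp actions are right actions: x acts here as left translation by
   x^-1. *)
Definition permrep_fun (I : finType) (p : I * {set gT}) (x : gT) :
  I * {set gT} := (p.1, x^-1 *: p.2).

Lemma permrep_fun1 (I : finType) : @permrep_fun I ^~ 1 =1 id.
Proof. by case=> i X; rewrite /permrep_fun /= invg1 mul1g. Qed.

Lemma permrep_funM (I : finType) p : act_morph (@permrep_fun I) p.
Proof. by case: p => i X x y; rewrite /permrep_fun /= invMg lcosetM. Qed.

Definition permrep (I : finType) : {action gT &-> I * {set gT}} :=
  TotalAction (@permrep_fun1 I) (@permrep_funM I).

Lemma permrep_acts G Hs :
  [acts G, on permrep_set G Hs | permrep 'I_(size Hs)].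
Proof.
apply/subsetP=> x Gx; rewrite !inE /=; apply/subsetP=> -[i X].
rewrite !inE /= => /lcosetsP[y Gy ->]; apply/lcosetsP.
by exists (x^-1 * y); rewrite ?groupM ?groupV ?lcosetM.
Qed.

Lemma card_permrep_set G Hs : subgroup_collection G Hs ->
  #|permrep_set G Hs| = (\sum_(H <- Hs) #|G : H|)%N.
Proof.
move/allP=> grHs; rewrite big_tnth -sum1_card.
rewrite (eq_bigl (fun p : 'I_(size Hs) * {set gT} => true
    && (p.2 \in lcosets (tnth (in_tuple Hs) p.1) G))); last first.
  by move=> p; rewrite inE.
rewrite -(pair_big_dep xpredT
  (fun i X => X \in lcosets (tnth (in_tuple Hs) i) G) (fun _ _ => 1%N)) /=.
apply: eq_bigr => i _; rewrite sum1_card.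
have /grHs/andP[gH _] : tnth (in_tuple Hs) i \in Hs by exact: mem_tnth.
exact: (card_lcosets G (Group gH)).
Qed.

End PermutationRepresentations.

Section SubgroupsOfGL.

Variable F : finFieldType.

Definition Asub (t : nat) : {group {unit F}} :=
  odflt 1%G [pick A : {group {unit F}} | #|A| == (#|F|.-1 %/ t)%N].

Lemma AsubP t (A : {group {unit F}}) : t %| #|F|.-1 ->
  (#|A| == #|F|.-1 %/ t)%N = (A :==: Asub t).
Proof.
move=> dvt; have cycU := field_unit_group_cyclic [set: {unit F}]%G.
have cardAs : #|Asub t| = (#|F|.-1 %/ t)%N.
  rewrite /Asub; case: pickP => [B /eqP //|noB].
  have [x defU] := cyclicP cycU.
  have ox : #[x] = #|F|.-1 by rewrite orderE -defU card_finField_unit.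
  have /eqP[] := noB <[x ^+ t]>%G.
  by rewrite /= -orderE orderXdiv ox.
by rewrite -cardAs (eq_subG_cyclic cycU) ?subsetT.
Qed.

Variable n : nat.

(* {'GL_n[F]} consists of matrices of size n.-1.+1, which is n for n > 0. *)
Definition GLsub (t : nat) : {set {'GL_n[F]}} :=
  [set h : {'GL_n[F]} | [exists u in Asub t, (\det (GLval h))%R == val u]].

Definition block_last (B : 'M[F]_n.-1) (x : 'cV[F]_n.-1) (b : F) :
  'M[F]_n.-1.+1 :=
  castmx (addn1 n.-1, addn1 n.-1)
    (block_mx B x (0%R : 'rV[F]_n.-1) (b%:M)%R).

Definition Psub : {set {'GL_n[F]}} :=
  [set h : {'GL_n[F]} | [exists B : 'M[F]_n.-1, exists x : 'cV[F]_n.-1,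
     exists b : F, [&& B \in unitmx, GLval h == block_last B x b
                     & (b^-1)%R == (\det B)%R]]].

(* (q-1)_{n,q} *)
Definition qm1_part (q : nat) : nat :=
  (\prod_(p <- primes q.-1 | p %| gcdn n q.-1) p ^ logn p q.-1)%N.

(* T_{n,q}(q-1) *)
Definition qm1_sum (q : nat) : nat :=
  (\sum_(p <- primes q.-1 | ~~ (p %| gcdn n q.-1)) p ^ logn p q.-1)%N.

Definition Qsub : {set {'GL_n[F]}} :=
  [set h : {'GL_n[F]} | [exists C : 'M[F]_n.-1, exists x : 'cV[F]_n.-1,
     exists c : F, [&& C \in unitmx, GLval h == block_last C x c,
                       (c^-1)%R == (\det C)%R
                     & [exists u in Asub (qm1_part #|F|), (\det C)%R == val u]]]].

Definition D1sub : {set {'GL_n[F]}} :=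
  [set h : {'GL_n[F]} | [exists a : F, (a != 0)%R &&
     (GLval h == diag_mx (\row_i if i == ord0 then a else 1))%R]].

End SubgroupsOfGL.

Arguments Asub : clear implicits.
Arguments GLsub : clear implicits.
Arguments Psub : clear implicits.
Arguments Qsub : clear implicits.
Arguments D1sub : clear implicits.

(* Main.v *)
(* Absorbing D_1 frees the determinant: Q D_1 consists of all h with
   e_n h = c e_n and c in A_m, where m = (q-1)_{n,q}. As GL_n is transitive on
   the q^n - 1 nonzero rows, its index is (q^n - 1) / |A_m| = m (q^n - 1)/(q - 1),
   and its core consists of the scalars c I with c in A_m, because every nonzero
   row is an eigenvector of a core element. Such a scalar lies in all the
   GL_n^(l^b) only if c^n has order prime to every l dividing the order of A_m;
   as no such l divides n, this forces c = 1. If gcd(n, q - 1) = 1, then m = 1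
   and P = Q. *)
Require Import Defs.
From mathcomp Require Import all_boot all_order all_fingroup all_algebra.
From mathcomp Require Import all_solvable.
Set Implicit Arguments.
Unset Strict Implicit.
Import GroupScope GRing.Theory.

(** The kernel of the action is normalised by G, so it lies in the core as soon as it lies in every
    member; and an element fixing the trivial coset of a member belongs to that member. *)
Lemma permrep_faithful (gT : finGroupType) (G : {group gT})
    (Hs : seq {set gT}) :
  subgroup_collection G Hs -> faithful_collection G Hs ->
  [faithful G, on permrep_set G Hs | permrep gT 'I_(size Hs)].
Proof.
move=> /allP grHs; rewrite /faithful_collection /faithful => <-.
rewrite sub_gcore; last first.
  by rewrite normsI ?normG // (subset_trans (permrep_acts G Hs)) ?astab_norm.
apply/subsetP=> x /setIP[Gx /astabP fixx].
rewrite big_tnth; apply/bigcapP=> i _.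
have /grHs/andP[gH _] : tnth (in_tuple Hs) i \in Hs by exact: mem_tnth.
have /fixx[eqH] : (i, tnth (in_tuple Hs) i) \in permrep_set G Hs.
  by rewrite inE; apply/lcosetsP; exists 1; rewrite ?mul1g.
suff: x^-1 \in Group gH by rewrite groupV.
have : x^-1 \in x^-1 *: Group gH by rewrite mem_lcoset invgK mulgV group1.
by rewrite /= eqH.
Qed.

(** * Subgroups of the multiplicative group of F *)

Section UnitSubgroups.

Variable F : finFieldType.

Lemma card_Asub t : t %| #|F|.-1 -> #|Asub F t| = (#|F|.-1 %/ t)%N.
Proof. by move=> dvt; apply/eqP; rewrite AsubP. Qed.

Lemma Asub1 : Asub F 1 = [set: {unit F}]%G.
Proof.
apply/val_inj/eqP; rewrite eqEcard subsetT /= card_Asub ?dvd1n //.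
by rewrite divn1 card_finField_unit leqnn.
Qed.

Lemma order_Asub t (u : {unit F}) :
  t %| #|F|.-1 -> u \in Asub F t -> #[u] %| (#|F|.-1 %/ t)%N.
Proof. by move=> dvt Au; rewrite -card_Asub // order_dvdG. Qed.

End UnitSubgroups.

(** * The determinant morphism and the index of GL_n^t *)

Section DetSubgroups.

Variables (F : finFieldType) (n : nat).

Lemma det_diag_first (a : F) :
  (\det (diag_mx (\row_(i < n.-1.+1) if i == ord0 then a else 1)) = a)%R.
Proof.
rewrite det_diag (bigD1 ord0) //= mxE eqxx big1 ?mulr1 // => i ni0.
by rewrite mxE (negPf ni0).
Qed.

(** Taking values in the group of units makes the determinant a group morphism, so that [GLsub] is a
    preimage under it. *)
Definition GLdet (h : {'GL_n[F]}) : {unit F} :=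
  FinRing.Unit (etrans (unitfE _) (GL_det h)).

Lemma GLdetM : {in 'GL_n[F] &, {morph GLdet : g h / g * h}}.
Proof. by move=> g h _ _; apply: val_inj; exact: det_mulmx. Qed.

Canonical GLdet_morphism := Morphism GLdetM.

Lemma GLsubE t : GLsub F n t = GLdet @*^-1 Asub F t.
Proof.
apply/setP=> h; rewrite !inE /=; apply/existsP/idP => [[u /andP[Au /eqP du]]|Ad].
  by rewrite (_ : GLdet h = u) //; apply: val_inj.
by exists (GLdet h); rewrite Ad /=.
Qed.

Lemma morphim_GLdet : GLdet @* 'GL_n[F] = [set: {unit F}].
Proof.
apply/setP=> u; rewrite inE; apply/morphimP.
pose D : 'M[F]_n.-1.+1 := diag_mx (\row_i if i == ord0 then val u else 1)%R.
have detD : (\det D = val u)%R := det_diag_first (val u).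
have uD : D \is a GRing.unit by rewrite unitmxE detD (valP u).
by exists (FinRing.Unit uD); rewrite ?inE //; apply: val_inj.
Qed.

(** As the determinant is onto the units, passing to preimages preserves indices, and A_t has index
    t in the units. *)
Lemma index_GLsub t : t %| #|F|.-1 -> #|'GL_n[F] : GLsub F n t| = t.
Proof.
move=> dvt; have F1 : 0 < #|F|.-1 by rewrite -card_finField_unit cardG_gt0.
have -> : 'GL_n[F] = GLdet @*^-1 [set: {unit F}] by rewrite morphpreT.
rewrite GLsubE index_morphpre ?morphim_GLdet ?subsetT //.
by rewrite -divgS ?subsetT // card_Asub // card_finField_unit divnA // mulKn.
Qed.

End DetSubgroups.

Lemma det_castmx (R : comPzRingType) m1 m2 (eq_m : m1 = m2) (A : 'M[R]_m1) :
  (\det (castmx (eq_m, eq_m) A) = \det A)%R.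
Proof. by case: m2 / eq_m; rewrite castmx_id. Qed.

(** * The action on row vectors and the stabiliser of a punctured line *)

Section RowAction.

Variables (F : finFieldType) (n : nat).
Implicit Types (h : {'GL_n[F]}) (A : {group {unit F}}).

Definition last_row : 'rV[F]_n.-1.+1 := delta_mx 0%R ord_max.

(** Rows rather than columns: multiplication gives a right action, and the block shape of P and Q is
    a condition on the image of e_n. *)
Definition rowact_fun (v : 'rV[F]_n.-1.+1) h : 'rV[F]_n.-1.+1 := (v *m h)%R.

Lemma rowact_fun1 : rowact_fun^~ 1 =1 id.
Proof. by move=> v; rewrite /rowact_fun GL_1E mulmx1. Qed.

Lemma rowact_funM v : act_morph rowact_fun v.
Proof. by move=> g h; rewrite /rowact_fun GL_MxE mulmxA. Qed.

Definition rowact : {action {'GL_n[F]} &-> 'rV[F]_n.-1.+1} :=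
  TotalAction rowact_fun1 rowact_funM.

Lemma last_row_neq0 : last_row != 0%R.
Proof.
by apply/eqP=> /matrixP/(_ 0%R ord_max)/eqP; rewrite !mxE !eqxx oner_eq0.
Qed.

Lemma last_row_trans (v : 'rV[F]_n.-1.+1) : v != 0%R ->
  exists h, (last_row *m GLval h)%R = v.
Proof.
(* Rank factorisation: v is c times the first row of the invertible [row_ebase v], where c is the 1
   by 1 unit [col_ebase v]; the transposition [P] takes e_n to e_1. *)
move=> v0; pose c := col_ebase v 0%R 0%R.
have c0 : c != 0%R.
  by have := col_ebase_unit v; rewrite unitmxE det_mx11 unitfE.
pose P : 'M[F]_n.-1.+1 := tperm_mx ord_max ord0.
have uM : (c *: (P *m row_ebase v))%R \is a GRing.unit.
  rewrite -[_ \is a _]/(_ \in unitmx) unitmxZ ?unitfE //.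
  by rewrite unitmx_mul unitmx_perm row_ebase_unit.
exists (FinRing.Unit uM); rewrite /GLval /= -scalemxAr mulmxA.
have -> : (last_row *m P = pid_mx 1)%R.
  by rewrite -rowE; apply/rowP=> j; rewrite !mxE tpermL andbT.
rewrite -{2}[v]mulmx_ebase rank_rV v0 [col_ebase v]mx11_scalar.
by rewrite mul_scalar_mx -scalemxAl.
Qed.

Lemma card_rowact_orbit : #|orbit rowact 'GL_n[F] last_row| = (#|F| ^ n.-1.+1).-1.
Proof.
have -> : orbit rowact 'GL_n[F] last_row = [set~ 0%R].
  apply/setP=> v; rewrite !inE; apply/orbitP/idP => [[h _ <-] | v0].
    by rewrite /= /rowact_fun mulmx_free_eq0 ?last_row_neq0 // row_free_unit GL_unitmx.
  by have [h eqh] := last_row_trans v0; exists h.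
by rewrite cardsC1 card_mx mul1n.
Qed.

(* Setwise stabiliser of the punctured line A e_n, for the action on rows. *)
Definition lineStab A : {set {'GL_n[F]}} :=
  [set h | [exists u in A, (last_row *m GLval h)%R == (val u *: last_row)%R]].

Lemma lineStabP A h :
  reflect (exists2 u, u \in A & (last_row *m GLval h = val u *: last_row)%R)
          (h \in lineStab A).
Proof.
rewrite inE; apply: (iffP existsP) => [[u /andP[Au /eqP]]|[u Au eqh]].
  by exists u.
by exists u; rewrite Au eqh eqxx.
Qed.

Lemma group_set_lineStab A : group_set (lineStab A).
Proof.
apply/group_setP; split=> [|g h /lineStabP[u Au eqg] /lineStabP[w Aw eqh]].
  by apply/lineStabP; exists 1; rewrite ?group1 // GL_1E mulmx1 scale1r.
apply/lineStabP; exists (u * w); first exact: groupM.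
by rewrite GL_MxE mulmxA eqg -scalemxAl eqh scalerA.
Qed.

(** Orbit-stabiliser is applied twice: the full group and [lineStab A] have the same stabiliser of
    e_n, while the orbits are the nonzero rows and A e_n. *)
Lemma card_lineStab A :
  (#|A| * #|'GL_n[F]| = (#|F| ^ n.-1.+1).-1 * #|lineStab A|)%N.
Proof.
pose K := Group (group_set_lineStab A).
have := card_orbit_stab rowact K last_row.
have := card_orbit_stab rowact 'GL_n[F] last_row.
rewrite card_rowact_orbit setTI.
have -> : 'C_K[last_row | rowact] = 'C[last_row | rowact].
  apply/setIidPr/subsetP=> h /astab1P fixh; apply/lineStabP.
  by exists 1; rewrite ?group1 // scale1r.
have -> : orbit rowact K last_row = [set (val u *: last_row)%R | u in A].
  apply/setP=> v; apply/orbitP/imsetP => [[h /lineStabP[u Au eqh] <-]|[u Au ->]].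
    by exists u.
  have [h eqh] : exists h, (last_row *m GLval h = val u *: last_row)%R.
    by apply: last_row_trans; rewrite scaler_eq0 negb_or last_row_neq0 -unitfE (valP u).
  by exists h => //; apply/lineStabP; exists u.
rewrite card_imset => [<- <-|u w /matrixP/(_ 0%R ord_max)]; last first.
  by rewrite !mxE !eqxx !mulr1 => /val_inj.
by rewrite mulnCA.
Qed.

Lemma index_lineStab A :
  (#|'GL_n[F] : lineStab A| * #|A| = (#|F| ^ n.-1.+1).-1)%N.
Proof.
pose K := Group (group_set_lineStab A).
have := card_lineStab A; rewrite -(LagrangeI _ K) (setIidPr (subsetT K)) /=.
move/eqP; rewrite mulnCA [in X in _ == X]mulnC eqn_pmul2l ?(cardG_gt0 K) //.
by rewrite mulnC => /eqP.
Qed.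

Lemma gcore_lineStab_scalar A h : h \in gcore (lineStab A) 'GL_n[F] ->
  exists2 u, u \in A & GLval h = (val u)%:M%R.
Proof.
move=> /bigcapP coreh.
have eig (v : 'rV[F]_n.-1.+1) : v != 0%R ->
    exists2 u, u \in A & (v *m GLval h = val u *: v)%R.
  move=> /last_row_trans[x <-].
  (* With v = e_n x, the element x h x^-1 scales e_n by u, so h scales v by u. *)
  have := coreh x (in_setT _); rewrite mem_conjg => /lineStabP[u Au].
  rewrite conjgE invgK mulgA !GL_MxE !mulmxA => equ; exists u => //.
  by rewrite scalemxAl -equ GL_VxE mulmxKV ?GL_unitmx.
have delta0 i : delta_mx 0%R i != 0%R :> 'rV[F]_n.-1.+1.
  by apply/eqP=> /matrixP/(_ 0%R i)/eqP; rewrite !mxE !eqxx oner_eq0.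
have [c Ac ec] := fin_all_exists2 (fun i => eig _ (delta0 i)).
have hE i j : GLval h i j = ((val (c i)) *+ (i == j))%R.
  have /rowP/(_ j) := ec i; rewrite -rowE !mxE => ->.
  by rewrite eqxx eq_sym mulr_natr.
exists (c ord_max) => //; apply/matrixP=> i j; rewrite hE !mxE.
have [-> // | nimax] := eqVneq i ord_max.
(* Since e_i + e_n is an eigenvector too, comparing its coordinates i and n shows that e_i and e_n
   have the same eigenvalue. *)
have sum0 : (delta_mx 0%R i + delta_mx 0%R ord_max : 'rV[F]_n.-1.+1)%R != 0%R.
  apply/eqP=> /matrixP/(_ 0%R i)/eqP.
  by rewrite !mxE !eqxx (negPf nimax) addr0 oner_eq0.
have [u _ equ] := eig _ sum0; congr (_ *+ _)%R; move: equ.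
rewrite mulmxDl !ec => /rowP equ; have := equ i; have := equ ord_max.
rewrite !mxE !eqxx [ord_max == i]eq_sym (negPf nimax) /=.
by rewrite !mulr0 !addr0 !add0r !mulr1 => -> ->.
Qed.

Lemma lineStab_D1 h : (1 < n)%N -> h \in D1sub F n ->
  (last_row *m GLval h = last_row)%R.
Proof.
move=> n1; rewrite inE => /existsP[a /andP[_ /eqP->]].
rewrite -rowE; apply/rowP=> j; rewrite !mxE.
have [_ | _] := eqVneq j ord_max; last by rewrite mulr0n.
(* The entry a occupies the first diagonal position, which differs from the last one because n >
   1. *)
by rewrite ifN // -val_eqE /= -lt0n -subn1 subn_gt0.
Qed.

Lemma block_last_row (B : 'M[F]_n.-1) x b :
  (last_row *m block_last B x b = b *: last_row)%R.
Proof.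
have castmax : cast_ord (esym (addn1 n.-1)) ord_max = rshift n.-1 ord0.
  by apply: val_inj; rewrite /= addn0.
rewrite -rowE; apply/rowP=> j; rewrite !mxE /block_last castmxE /= castmax.
rewrite -(inj_eq (@cast_ord_inj _ _ (esym (addn1 n.-1))) j) castmax.
case: (split_ordP (cast_ord (esym (addn1 n.-1)) j)) => k ->.
  by rewrite block_mxEdl mxE eq_lrshift mulr0.
by rewrite block_mxEdr mxE !ord1 !eqxx mulr1.
Qed.

Lemma det_block_last (B : 'M[F]_n.-1) x b :
  (\det (block_last B x b) = \det B * b)%R.
Proof. by rewrite /block_last det_castmx det_ublock det_mx11 !mxE eqxx. Qed.

(** The image of e_n is the bottom row of M, so the hypothesis fixes both lower blocks and leaves
    the upper ones free. *)
Lemma block_lastP (M : 'M[F]_n.-1.+1) c : (last_row *m M = c *: last_row)%R ->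
  exists B, exists x, M = block_last B x c.
Proof.
move=> eqM; pose M' := castmx (esym (addn1 n.-1), esym (addn1 n.-1)) M.
have castmax (i : 'I_1) : cast_ord (addn1 n.-1) (rshift n.-1 i) = ord_max.
  by apply: val_inj; rewrite /= ord1 addn0.
have Mmax j : (M ord_max j = c * (j == ord_max)%:R)%R.
  by have /rowP/(_ j) := eqM; rewrite -rowE !mxE.
exists (ulsubmx M'), (ursubmx M').
rewrite -[LHS](castmxKV (addn1 n.-1) (addn1 n.-1)) /block_last -/M'.
rewrite -{1}[M']submxK; congr (castmx _ (block_mx _ _ _ _)).
  apply/matrixP=> i j; rewrite !mxE castmxE /= !esymK castmax Mmax.
  by rewrite -val_eqE /= ltn_eqF ?mulr0.
apply/matrixP=> i j; rewrite !mxE castmxE /= !esymK !castmax Mmax.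
by rewrite !ord1 !eqxx mulr1.
Qed.

Lemma Qsub_D1sub : (1 < n)%N ->
  Qsub F n * D1sub F n = lineStab (Asub F (qm1_part n #|F|)).
Proof.
move=> n1; apply/setP=> h; apply/mulsgP/lineStabP.
  case=> g d; rewrite inE => /existsP[C /existsP[x /existsP[c]]].
  case/and4P=> _ /eqP eqg /eqP detC /exists_inP[u Au /eqP eu] D1d ->.
  exists u^-1; first by rewrite groupV.
  rewrite GL_MxE mulmxA eqg block_last_row -scalemxAl lineStab_D1 //.
  by rewrite FinRing.val_unitV -eu -detC invrK.
(* Dividing h by d = diag(det h, 1, ..., 1) keeps the last row and makes the determinant 1, which
   forces det C = u^-1. *)
case=> u Au equ; pose a := (\det (GLval h))%R.
have a0 : a != 0%R := GL_det h.
pose D : 'M[F]_n.-1.+1 := diag_mx (\row_i if i == ord0 then a else 1)%R.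
have detD : (\det D = a)%R := det_diag_first n a.
have uD : D \is a GRing.unit by rewrite unitmxE detD unitfE.
pose d : {'GL_n[F]} := FinRing.Unit uD.
have D1d : d \in D1sub F n by rewrite inE; apply/existsP; exists a; rewrite a0 /=.
exists (h * d^-1) d; rewrite ?mulgKV //.
have eqg : (last_row *m GLval (h * d^-1) = val u *: last_row)%R.
  rewrite GL_MxE mulmxA equ -scalemxAl -{1}(lineStab_D1 n1 D1d).
  by rewrite GL_VxE mulmxK ?GL_unitmx.
have [C [x eqC]] := block_lastP eqg.
have detC : (\det C * val u = 1)%R.
  by rewrite -(det_block_last _ x) -eqC GL_MxE det_mulmx GL_VxE det_inv detD divff.
have u0 : val u != 0%R by rewrite -unitfE (valP u).
have eC : (\det C = (val u)^-1)%R by rewrite -[LHS]mulr1 -(divff u0) mulrA detC mul1r.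
rewrite inE; apply/existsP; exists C; apply/existsP; exists x.
apply/existsP; exists (val u); rewrite unitmxE eC unitrV (valP u) eqC !eqxx /=.
by apply/exists_inP; exists u^-1; rewrite ?groupV.
Qed.

(** A_1 is the whole group of units, so the extra determinant condition in [Qsub] holds for every
    invertible block. *)
Lemma PsubE : qm1_part n #|F| = 1%N -> Psub F n = Qsub F n.
Proof.
move=> m1; apply/setP=> h; rewrite !inE; apply: eq_existsb => C.
apply: eq_existsb => x; apply: eq_existsb => c; rewrite m1 Asub1.
case uC: (C \in unitmx) => //=; congr (_ && _); case: (_^-1 == _)%R => //=.
apply/esym/exists_inP; rewrite unitmxE in uC.
by exists (FinRing.Unit uC); rewrite ?inE.
Qed.

End RowAction.

(** * Prime divisors of products of prime powers *)

Lemma prime_dvd_prod_pow (I : finType) (P : pred I) (p e : I -> nat) l :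
  prime l -> (forall i, prime (p i)) -> l %| (\prod_(i | P i) p i ^ e i)%N ->
  exists2 i, P i & l = p i.
Proof.
move=> l_pr p_pr; apply: (big_ind (fun m => l %| m -> exists2 i, P i & l = p i)).
- by rewrite dvdn1 => /eqP l1; rewrite l1 in l_pr.
- by move=> x y IHx IHy; rewrite Euclid_dvdM // => /orP[/IHx | /IHy].
move=> i Pi; rewrite Euclid_dvdX // => /andP[]; rewrite dvdn_prime2 // => /eqP.
by exists i.
Qed.

Lemma prod_primes_pow m :
  0 < m -> (\prod_(l <- primes m) l ^ logn l m = m)%N.
Proof.
by move=> m0; rewrite [RHS]prod_prime_decomp // prime_decompE big_map.
Qed.

Lemma qm1_part_dvd n q : 0 < q.-1 -> qm1_part n q %| q.-1.
Proof.
move=> m0; rewrite -[X in _ %| X](prod_primes_pow m0).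
by rewrite (bigID (fun l => l %| gcdn n q.-1)) dvdn_mulr.
Qed.

(** The quotient is the product of the prime powers of q - 1 at primes not dividing the gcd; a prime
    factor of q - 1 outside the gcd cannot divide n. This controls the primes dividing the order of
    A_m. *)
Lemma prime_dvd_qm1_copart n q l : prime l -> 0 < q.-1 ->
  l %| (q.-1 %/ qm1_part n q)%N -> ~~ (l %| n) && (l \in primes q.-1).
Proof.
move=> l_pr m0; rewrite -{1}(prod_primes_pow m0).
rewrite (bigID (fun l => l %| gcdn n q.-1)) -/(qm1_part n q) /= mulKn; last first.
  by rewrite (dvdn_gt0 m0) // qm1_part_dvd.
rewrite big_seq_cond.
apply: (big_ind (fun m => l %| m -> _)).
- by rewrite dvdn1 => /eqP l1; rewrite l1 in l_pr.
- by move=> x y IHx IHy; rewrite Euclid_dvdM // => /orP[/IHx | /IHy].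
move=> x /andP[x_m]; rewrite Euclid_dvdX // dvdn_gcd => nx /andP[].
have [x_pr _ x_dv] : [/\ prime x, 0 < q.-1 & x %| q.-1].
  by apply/and3P; rewrite -mem_primes.
by move: nx; rewrite x_dv andbT => nx; rewrite dvdn_prime2 // => /eqP->; rewrite nx.
Qed.

(** * Faithfulness and size of the collection *)

Section Faithful.

Variables (F : finFieldType) (n : nat).

Let m0 : 0 < #|F|.-1.
Proof. by rewrite -card_finField_unit cardG_gt0. Qed.

(* A prime l dividing the order of u divides q - 1 but not n, so it divides
   the order of u ^+ n too; but A_(l^b) has order prime to l. *)
Lemma Asub_eq1 (u : {unit F}) : u \in Asub F (qm1_part n #|F|) ->
  (forall l, l \in primes #|F|.-1 -> ~~ (l %| gcdn n #|F|.-1) ->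
     u ^+ n \in Asub F (l ^ logn l #|F|.-1)) ->
  u = 1.
Proof.
move=> Au Aun; apply/eqP; rewrite -order_eq1; apply: contraT => o1.
have l_pr := pdiv_prime (_ : 1 < #[u]); set l := pdiv _ in l_pr.
have {}l_pr : prime l by apply: l_pr; rewrite ltn_neqAle eq_sym o1 order_gt0.
have lu : l %| #[u] := pdiv_dvd _.
have /andP[ln lm] := prime_dvd_qm1_copart l_pr m0
  (dvdn_trans lu (order_Asub (qm1_part_dvd n m0) Au)).
have lg : ~~ (l %| gcdn n #|F|.-1).
  by apply: contra ln => /dvdn_trans-> //; apply: dvdn_gcdl.
have := order_Asub (pfactor_dvdnn l _) (Aun l lm lg).
rewrite order_dvdn -expgM -order_dvdn => /(dvdn_trans lu).
rewrite Euclid_dvdM // (negPf ln) /= => ldv.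
have : l ^ (logn l #|F|.-1).+1 %| #|F|.-1.
  by rewrite expnS -[X in _ %| X](divnK (pfactor_dvdnn l _)) dvdn_mul.
by rewrite pfactor_dvdn // ltnn.
Qed.

(** The primes are taken up to permutation because the theorem indexes them in an arbitrary
    order. *)
Variable Ls : seq nat.
Hypothesis perm_Ls :
  perm_eq Ls [seq l <- primes #|F|.-1 | ~~ (l %| gcdn n #|F|.-1)].
Hypothesis n_gt1 : 1 < n.

Let GLs := [seq GLsub F n (l ^ logn l #|F|.-1) | l <- Ls].
Let Hs := lineStab n (Asub F (qm1_part n #|F|)) :: GLs.

Lemma lineStab_collection : subgroup_collection 'GL_n[F]%G Hs.
Proof.
rewrite /subgroup_collection /= subsetT group_set_lineStab /=.
by apply/allP=> _ /mapP[l _ ->]; rewrite subsetT GLsubE groupP.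
Qed.

Lemma lineStab_faithful : faithful_collection 'GL_n[F]%G Hs.
Proof.
apply/setP=> h; rewrite inE; apply/idP/eqP => [coreh | ->]; last first.
  have /allP grHs := lineStab_collection.
  apply/bigcapP=> x _; rewrite mem_conjg conj1g bigcap_seq.
  by apply/bigcapP=> H /grHs/andP[gH _]; apply: (group1 (Group gH)).
have inHs H : H \in Hs -> \bigcap_(K <- Hs) K \subset H.
  by move=> HsH; rewrite bigcap_seq bigcap_inf.
(* The core of the intersection is a normalised subset of [lineStab], hence lies in the core of
   [lineStab]. *)
have [|u Au eqh] := @gcore_lineStab_scalar F n (Asub F (qm1_part n #|F|)) h.
  apply: subsetP coreh; rewrite gcore_max ?gcore_norm //.
  by rewrite (subset_trans (gcore_sub _ _)) ?inHs ?mem_head.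
suff u1 : u = 1 by apply: val_inj; rewrite [LHS]eqh u1.
apply: Asub_eq1 Au _ => l lm lg.
have : h \in GLsub F n (l ^ logn l #|F|.-1).
  apply: subsetP coreh; rewrite (subset_trans (gcore_sub _ _)) ?inHs //.
  by apply: (@mem_behead _ Hs); apply: map_f; rewrite (perm_mem perm_Ls) mem_filter lg.
(* The scalar matrix u I has determinant u^n; [prednK] identifies the matrix size with n as n is
   positive. *)
rewrite inE => /exists_inP[w Aw]; rewrite eqh det_scalar prednK ?(ltnW n_gt1) //.
by rewrite -FinRing.val_unitX => /eqP/val_inj->.
Qed.

Lemma lineStab_permrep_size :
  #|permrep_set 'GL_n[F]%G Hs|
    = ((#|F| ^ n - 1) %/ (#|F| - 1) * qm1_part n #|F| + qm1_sum n #|F|)%N.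
Proof.
rewrite card_permrep_set ?lineStab_collection // big_cons big_map.
congr (_ + _)%N.
  have dvm := qm1_part_dvd n m0; have := index_lineStab n (Asub F (qm1_part n #|F|)).
  rewrite card_Asub // prednK ?(ltnW n_gt1) // !subn1 predn_exp mulKn //.
  (* Here q^n - 1 = (q - 1) S, and |A_m| = (q - 1)/m is cancelled from index * |A_m| = |A_m| * m *
     S. *)
  set S := (\sum_(i < n) _)%N; have qm0 : 0 < #|F|.-1 %/ qm1_part n #|F|.
    by rewrite divn_gt0 ?(dvdn_leq m0) // (dvdn_gt0 m0).
  rewrite -{2}(divnK dvm) -mulnA mulnC => /eqP.
  by rewrite eqn_pmul2l // mulnC => /eqP.
rewrite (perm_big _ perm_Ls) big_filter /qm1_sum.
by apply: eq_bigr => l _; rewrite index_GLsub // pfactor_dvdnn.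
Qed.

End Faithful.

Theorem proposition3p4 (F : finFieldType) (q n : nat) (hq : #|F| = q)
    (hn : (2 <= n)%N) (s t : nat)
    (p r a : 'I_s -> nat) (l b : 'I_t -> nat)
    (p_prime : forall i, prime (p i)) (l_prime : forall j, prime (l j))
    (p_inj : injective p) (l_inj : injective l)
    (pl_neq : forall i j, p i <> l j)
    (r_ge1 : forall i, (1 <= r i)%N) (b_ge1 : forall j, (1 <= b j)%N)
    (hg : gcdn n (q - 1) = (\prod_(i < s) p i ^ r i)%N)
    (hq1 : (q - 1 = (\prod_(i < s) p i ^ a i) * (\prod_(j < t) l j ^ b j))%N) :
  let G := 'GL_n[F]%G in
  let GLs := [seq GLsub F n (l j ^ b j)%N | j <- enum 'I_t] in
  let QHs := (Qsub F n * D1sub F n) :: GLs in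
  let PHs := (Psub F n * D1sub F n) :: GLs in
  [/\ subgroup_collection G QHs,
      faithful_collection G QHs,
      [faithful G, on permrep_set G QHs | permrep {'GL_n[F]} 'I_(size QHs)]
    & #|permrep_set G QHs|
      = ((q ^ n - 1) %/ (q - 1) * qm1_part n q + qm1_sum n q)%N] /\
  (gcdn n (q - 1) = 1%N ->
   [/\ subgroup_collection G PHs,
       faithful_collection G PHs,
       [faithful G, on permrep_set G PHs | permrep {'GL_n[F]} 'I_(size PHs)]
     & #|permrep_set G PHs| = ((q ^ n - 1) %/ (q - 1) + qm1_sum n q)%N]).
Proof.
move: hg hq1; rewrite -hq subn1 => hg' hq1'.
have m0 : 0 < #|F|.-1 by rewrite -card_finField_unit cardG_gt0.
have l_m j : l j \in primes #|F|.-1.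
  rewrite mem_primes l_prime m0 hq1' (bigD1 j) //= mulnCA.
  by rewrite dvdn_mulr // dvdn_exp.
have l_g j : ~~ (l j %| gcdn n #|F|.-1).
  rewrite hg'; apply/negP=> /(prime_dvd_prod_pow (l_prime j) p_prime)[i _ eqlp].
  exact: (pl_neq i j).
(* The cofactor [R] of l_j^b_j in q - 1 is prime to l_j because all the listed primes are distinct,
   so b_j is the full valuation. *)
have l_b j : logn (l j) #|F|.-1 = b j.
  move: m0; rewrite hq1' (bigD1 j) //= mulnCA.
  set R := (_ * \prod_(i | _) _)%N; rewrite muln_gt0 => /andP[lb0 R0].
  suff lR : ~~ (l j %| R).
    by rewrite lognM // pfactorK // lognE (negPf lR) !andbF addn0.
  rewrite Euclid_dvdM // negb_or; apply/andP; split; apply/negP.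
    by move=> /(prime_dvd_prod_pow (l_prime j) p_prime)[i _ /esym/pl_neq].
  by case/(prime_dvd_prod_pow (l_prime j) l_prime)=> i /eqP ij /l_inj/esym.
pose Ls := [seq l j | j <- enum 'I_t].
have perm_Ls : perm_eq Ls [seq l <- primes #|F|.-1 | ~~ (l %| gcdn n #|F|.-1)].
  apply: uniq_perm; [|by rewrite filter_uniq ?primes_uniq|move=> x].
    by rewrite (map_inj_uniq l_inj) enum_uniq.
  rewrite mem_filter; apply/mapP/andP=> [[j _ ->] // | [xg]].
  rewrite mem_primes => /and3P[x_pr _]; rewrite hq1' Euclid_dvdM // => /orP[].
    (* As r_i >= 1, each p_i divides the gcd; a prime factor of q - 1 outside the gcd is therefore
       some l_j. *)
    move=> /(prime_dvd_prod_pow x_pr p_prime)[i _ eqxp]; case/negP: xg.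
    by rewrite hg' (bigD1 i) //= dvdn_mulr // eqxp dvdn_exp.
  move=> /(prime_dvd_prod_pow x_pr l_prime)[j _ ->].
  by exists j; rewrite ?mem_enum.
have GLsE : [seq GLsub F n (l j ^ b j) | j <- enum 'I_t] =
            [seq GLsub F n (l ^ logn l #|F|.-1) | l <- Ls].
  by rewrite /Ls -map_comp; apply/eq_map=> j /=; rewrite l_b.
move=> G GLs QHs PHs.
have QHsE : QHs = lineStab n (Asub F (qm1_part n #|F|)) ::
            [seq GLsub F n (l ^ logn l #|F|.-1) | l <- Ls].
  by rewrite /QHs Qsub_D1sub // /GLs GLsE.
have mainQ : [/\ subgroup_collection G QHs, faithful_collection G QHs,
    [faithful G, on permrep_set G QHs | permrep {'GL_n[F]} 'I_(size QHs)]
  & #|permrep_set G QHs| = 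
    ((#|F| ^ n - 1) %/ (#|F| - 1) * qm1_part n #|F| + qm1_sum n #|F|)%N].
  rewrite QHsE; split.
  - exact: lineStab_collection.
  - exact: lineStab_faithful.
  - by apply: permrep_faithful; [apply: lineStab_collection | apply: lineStab_faithful].
  - exact: lineStab_permrep_size.
split; first by rewrite -subn1 in mainQ *.
move=> g1.
(* No prime divides a gcd equal to 1, so the product is empty. *)
have m1 : qm1_part n #|F| = 1%N.
  rewrite /qm1_part g1 big_seq_cond big1 // => x /andP[].
  by rewrite mem_primes dvdn1 => /andP[/prime_gt1]; case: x => [|[]].
by move: mainQ; rewrite /PHs PsubE // m1 muln1 -?subn1.
Qed.
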